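(* The optimum of the platform's profit-maximization problem $$\max_{p_v,\pi}\ \lambda p_v - Nw - KC$$ subject to the market equilibrium constraints $$\lambda = \tau\lambda_0F_v\big(p_v+\alpha(t_r+t_p)+\beta(2t_d+t_w)\big),\qquad N = N_0F_c(w),$$ $$t_r = \frac{\rho_d^{\sqrt{2N+2}}}{2\lambda(1-\rho_d)},\qquad t_p = \frac{\phi}{\sqrt{(N-2\lambda(t_p+t_d))/A}},\qquad t_w = \frac{K\rho_c^{\sqrt{2S+2}}}{\lambda(1-\rho_c)},$$ always falls in a regime where $$\frac{\partial t_p}{\partial\lambda}>0,$$ i.e., under a fixed supply $N$, the pickup time $t_p$ increases with the demand $\lambda$.
   Context: Exogenous positive constants: $\tau$ (fraction of EVs needing charging per unit time), $\lambda_0$ (number of potential private vehicle owners), $N_0$ (number of potential couriers), $A$ (city area), $K$ (number of charging stations), $S$ (chargers per station), $t_c$ (mean charging time), $C$ (per-time wage of the coordinator at each station), $\phi,\theta$ (model parameters), and values of time $\alpha>\beta>0$. Decision variables of the platform: the service price $p_v$ and the per-time payment $\pi$ to couriers. Endogenous quantities (treated as real numbers): arrival rate of customers $\lambda>0$, number of couriers $N>0$, average courier wage $w$, pickup time $t_p$, response time $t_r$, waiting time $t_w$. The delivery time is $t_d=\theta\sqrt{A/K}$. The average wage is $w = 2\lambda\,\pi\,(t_p+t_d)/N$ (each customer generates two deliveries, each paid $\pi(t_p+t_d)$ on average). $F_v$ is a decreasing function (demand as a function of generalized cost) and $F_c$ is a strictly increasing function (supply as a function of wage). The utilization rates are $\rho_d=2\lambda(t_p+t_d)/N<1$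 and $\rho_c=\lambda t_c/(KS)<1$, so $\lambda<\min\{KS/t_c,\,N/(2(t_p+t_d))\}$. The number of idle couriers is $N_i = N-2\lambda t_p-2\lambda t_d>0$, so $t_p=\phi/\sqrt{N_i/A}$ and $$N_i = N-2\lambda\left(\frac{\phi}{\sqrt{N_i/A}}+t_d\right).$$ For given $(\lambda,N)$ this equation may have two positive roots $N_i$, corresponding to two different market outcomes; the maximization ranges over all market outcomes. The partial derivative $\partial t_p/\partial\lambda$ is that of $t_p$ as the function of $(\lambda,N)$ implicitly defined by this equation (on the branch of the root $N_i$ attained at the optimum), with $N$ held fixed.
   Formalization: If F_v may jump, the optimum can lie where the two roots N_i merge and ∂t_p/∂λ is undefined; so ∂t_p/∂λ > 0 is proved wherever t_p is locally a continuous function of (λ,N), and that this holds at the optimum is proved for continuous F_v. *)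

(* Defs.v *)
(* Stdlib reals with Coquelicot. *)
From Stdlib Require Import Reals.
From Coquelicot Require Import Coquelicot.
Open Scope R_scope.

(* [stations] and [chargers] are real, which includes the integer case. *)
Record model := Model {
  tau : R;
  lambda0 : R;
  N0 : R;
  area : R;
  stations : R;
  chargers : R;
  tc : R;
  coord_wage : R;
  phi : R;
  theta : R;
  alpha : R;
  beta : R;
  Fv : R -> R;
  Fc : R -> R
}.

(* [decreasing] is non-strict, [strict_increasing] is strict. *)
Record model_assumptions (M : model) : Prop := {
  tau_gt0 : 0 < tau M;
  lambda0_gt0 : 0 < lambda0 M;
  N0_gt0 : 0 < N0 M;
  area_gt0 : 0 < area M;
  stations_gt0 : 0 < stations M;
  chargers_gt0 : 0 < chargers M;
  tc_gt0 : 0 < tc M;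
  coord_wage_gt0 : 0 < coord_wage M;
  phi_gt0 : 0 < phi M;
  theta_gt0 : 0 < theta M;
  beta_gt0 : 0 < beta M;
  beta_lt_alpha : beta M < alpha M;
  Fv_decreasing : decreasing (Fv M);
  Fc_increasing : strict_increasing (Fc M)
}.

Record outcome := Outcome {
  price : R;      (* p_v *)
  payment : R;    (* pi *)
  arrival : R;    (* lambda *)
  couriers : R;   (* N *)
  wage : R;       (* w *)
  pickup : R;     (* t_p *)
  response : R;   (* t_r *)
  waiting : R     (* t_w *)
}.

Definition delivery (M : model) : R := theta M * sqrt (area M / stations M).

Definition idle (M : model) (l n t : R) : R := n - 2 * l * t - 2 * l * delivery M.

Definition pickup_eq (M : model) (l n t : R) : Prop :=
  0 < idle M l n t /\ t = phi M / sqrt (idle M l n t / area M).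

Definition rho_d (M : model) (X : outcome) : R :=
  2 * arrival X * (pickup X + delivery M) / couriers X.

Definition rho_c (M : model) (X : outcome) : R :=
  arrival X * tc M / (stations M * chargers M).

Definition generalized_cost (M : model) (X : outcome) : R :=
  price X + alpha M * (response X + pickup X)
          + beta M * (2 * delivery M + waiting X).

(* [Rpower] is real exponentiation for a positive base; both utilization rates
   are positive at an equilibrium. *)
Record equilibrium (M : model) (X : outcome) : Prop := {
  arrival_gt0 : 0 < arrival X;
  couriers_gt0 : 0 < couriers X;
  rho_d_lt1 : rho_d M X < 1;
  rho_c_lt1 : rho_c M X < 1;
  demand_eq : arrival X = tau M * lambda0 M * Fv M (generalized_cost M X);
  supply_eq : couriers X = N0 M * Fc M (wage X);
  wage_eq : wage X =
    2 * arrival X * payment X * (pickup X + delivery M) / couriers X;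
  response_eq : response X =
    Rpower (rho_d M X) (sqrt (2 * couriers X + 2))
      / (2 * arrival X * (1 - rho_d M X));
  pickup_eqn : pickup_eq M (arrival X) (couriers X) (pickup X);
  waiting_eq : waiting X =
    stations M * Rpower (rho_c M X) (sqrt (2 * chargers M + 2))
      / (arrival X * (1 - rho_c M X))
}.

Definition profit (M : model) (X : outcome) : R :=
  arrival X * price X - couriers X * wage X - stations M * coord_wage M.

(* The competitors [Y] include every equilibrium compatible with a given
   [(price, payment)], in particular both roots of the pickup equation. *)
Definition optimum (M : model) (X : outcome) : Prop :=
  equilibrium M X /\ forall Y, equilibrium M Y -> profit M Y <= profit M X.

(* [g] is the implicit function t_p(lambda, N) through the outcome [X].  No such
   [g] exists where the two roots of the pickup equation merge: the equation then
   has no root for slightly larger lambda. *)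
Definition pickup_branch (M : model) (X : outcome) (g : R -> R -> R) : Prop :=
  g (arrival X) (couriers X) = pickup X /\
  continuity_2d_pt g (arrival X) (couriers X) /\
  locally_2d (fun l n => pickup_eq M l n (g l n)) (arrival X) (couriers X).

(* Main.v *)
Require Import Defs.
From Stdlib Require Import Reals Lra ClassicalEpsilon.
From Coquelicot Require Import Coquelicot.
Open Scope R_scope.

(** Write [a] for [phi ^ 2 * area].  In terms of the pickup time alone, the
    pickup equation reads [n = a / t ^ 2 + 2 l (t + t_d)], whose right-hand side
    is convex in [t] with minimum where [l t ^ 3 = a].  Its root with
    [l t ^ 3 < a] is the one along which the pickup time increases with [l].

    An optimum cannot lie at the other root.  With arrival rate, couriers and
    wage unchanged, passing to the smaller root shortens pickup and response
    times, and the platform can raise the price by the saved cost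
    ([optimum_no_better], [optimum_subcritical]).

    At the critical point [l t ^ 3 = a] the equation has no root for slightly
    larger [l], so no branch passes through it ([critical_no_root]).  When the
    demand function is continuous, the critical point is not optimal either:
    lowering the pickup time by [s] costs only [O(s ^ 2)] customers, and fewer
    customers also mean a higher admissible generalized cost and shorter
    response and waiting times, so that the price can rise by at least
    [alpha s] ([optimum_not_critical]).

    Away from the critical point, the difference of two pickup equations
    factors ([pickup_curve_diff]).  The factorization gives both the derivative
    of any branch, in Caratheodory's form ([branch_is_derive]), and the
    Lipschitz continuity of the branch of small roots ([branch_exists]). *)

(** * The pickup equation *)

(* Goals [x <> 0] where [x] is a product of visibly positive factors. *)
Ltac solve_pos_neq :=
  repeat split; apply Rgt_not_eq; repeat apply Rmult_lt_0_compat; lra.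

(** The constant [a] for which a pickup time [t] requires [a / t ^ 2] idle
    couriers. *)
Definition idle_scale (M : model) : R := phi M ^ 2 * area M.

(** The number of couriers for which [t] is an equilibrium pickup time at
    arrival rate [l]. *)
Definition pickup_curve (M : model) (l t : R) : R :=
  idle_scale M / t ^ 2 + 2 * l * (t + delivery M).

Lemma idle_scale_gt0 M : model_assumptions M -> 0 < idle_scale M.
Proof.
intros hM; unfold idle_scale.
apply Rmult_lt_0_compat; [apply pow_lt|]; apply hM.
Qed.

Lemma delivery_gt0 M : model_assumptions M -> 0 < delivery M.
Proof.
intros hM; unfold delivery.
apply Rmult_lt_0_compat; [apply hM|].
apply sqrt_lt_R0, Rdiv_lt_0_compat; apply hM.
Qed.

Lemma pickup_eqE M l n t : model_assumptions M ->
  pickup_eq M l n t <-> 0 < t /\ n = pickup_curve M l t.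
Proof.
intros hM.
pose proof (phi_gt0 M hM) as hphi; pose proof (area_gt0 M hM) as hA.
unfold pickup_eq, pickup_curve, idle_scale; split.
- intros [hu ht].
  assert (hq : 0 < idle M l n t / area M) by (apply Rdiv_lt_0_compat; lra).
  pose proof (sqrt_lt_R0 _ hq) as hs.
  assert (ht0 : 0 < t) by (rewrite ht; apply Rdiv_lt_0_compat; lra).
  split; [exact ht0|].
  assert (e1 : t * sqrt (idle M l n t / area M) = phi M).
  { rewrite ht at 1; field; lra. }
  pose proof (sqrt_sqrt _ (Rlt_le _ _ hq)) as e2.
  assert (e3 : phi M ^ 2 * area M = t ^ 2 * idle M l n t).
  { rewrite <- e1, Rpow_mult_distr, <- (Rsqr_pow2 (sqrt _)).
    unfold Rsqr; rewrite e2; field; lra. }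
  rewrite e3.
  replace (t ^ 2 * idle M l n t / t ^ 2) with (idle M l n t) by (field; lra).
  unfold idle; ring.
- intros [ht hn].
  assert (hi : idle M l n t = phi M ^ 2 * area M / t ^ 2).
  { unfold idle; rewrite hn; ring. }
  rewrite hi; split.
  + apply Rdiv_lt_0_compat; [|apply pow_lt; lra].
    apply Rmult_lt_0_compat; [apply pow_lt|]; lra.
  + replace (phi M ^ 2 * area M / t ^ 2 / area M) with ((phi M / t) ^ 2)
      by (field; lra).
    rewrite sqrt_pow2; [field; lra|].
    apply Rlt_le, Rdiv_lt_0_compat; lra.
Qed.

Lemma pickup_curve_diff M l t l' t' : 0 < t -> 0 < t' ->
  pickup_curve M l' t' - pickup_curve M l t =
    2 * (l' - l) * (t' + delivery M)
    - (t' - t) * (idle_scale M * (t' + t) / (t' ^ 2 * t ^ 2) - 2 * l).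
Proof. intros ht ht'; unfold pickup_curve; field; lra. Qed.

(** The bracket in [pickup_curve_diff] is bounded below, uniformly in two
    pickup times that do not exceed [b]. *)
Lemma slope_ge M b t t' : 0 < idle_scale M -> 0 < t <= b -> 0 < t' <= b ->
  2 * idle_scale M / b ^ 3 <= idle_scale M * (t' + t) / (t' ^ 2 * t ^ 2).
Proof.
intros ha ht ht'.
assert (hinv : forall x y, 0 < x <= b -> 0 < y <= b ->
  / b ^ 3 <= / (x * y ^ 2)).
{ intros x y hx hy; apply Rinv_le_contravar.
  - apply Rmult_lt_0_compat; [|apply pow_lt]; lra.
  - replace (b ^ 3) with (b * b ^ 2) by ring.
    apply Rmult_le_compat; [lra|apply pow2_ge_0|lra|apply pow_incr; lra]. }
replace (idle_scale M * (t' + t) / (t' ^ 2 * t ^ 2))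
  with (idle_scale M * (/ (t' * t ^ 2) + / (t * t' ^ 2))) by (field; lra).
replace (2 * idle_scale M / b ^ 3)
  with (idle_scale M * (/ b ^ 3 + / b ^ 3)) by (field; lra).
apply Rmult_le_compat_l; [lra|].
apply Rplus_le_compat; apply hinv; assumption.
Qed.

(** Past the critical point there is an explicit smaller root: apart from [t]
    itself, the roots of the cubic satisfy the quadratic equation
    [2 l t^2 s^2 = a (s + t)]. *)
Lemma smaller_root M l t : 0 < idle_scale M -> 0 < l -> 0 < t ->
  idle_scale M < l * t ^ 3 ->
  exists s, 0 < s < t /\ pickup_curve M l s = pickup_curve M l t.
Proof.
intros ha hl ht hcrit; set (a := idle_scale M) in *.
assert (ht2 : 0 < t ^ 2) by (apply pow_lt; lra).
assert (ht3 : 0 < t ^ 3) by (apply pow_lt; lra).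
assert (hlt2 : 0 < l * t ^ 2) by (apply Rmult_lt_0_compat; lra).
assert (hd : 0 <= a ^ 2 + 8 * l * t ^ 3 * a).
{ assert (0 < l * t ^ 3) by lra; nra. }
pose (q := sqrt (a ^ 2 + 8 * l * t ^ 3 * a)).
assert (hq0 : 0 <= q) by apply sqrt_pos.
assert (hq2 : q * q = a ^ 2 + 8 * l * t ^ 3 * a) by (apply sqrt_sqrt; lra).
pose (s := (a + q) / (4 * (l * t ^ 2))).
assert (hs : 4 * (l * t ^ 2) * s = a + q) by (unfold s; field; lra).
assert (hs0 : 0 < s) by (apply Rdiv_lt_0_compat; lra).
assert (hquad : 2 * l * (s ^ 2 * t ^ 2) = a * (s + t)).
{ apply Rmult_eq_reg_l with (8 * (l * t ^ 2)); [|lra].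
  transitivity ((4 * (l * t ^ 2) * s) ^ 2); [ring|].
  transitivity (2 * a * (4 * (l * t ^ 2) * s) + 8 * l * t ^ 3 * a); [|ring].
  rewrite hs.
  transitivity (a ^ 2 + 2 * a * q + q * q); [ring|rewrite hq2; ring]. }
exists s; repeat split; [exact hs0| |].
- assert (hf : t * (2 * t * (l * t ^ 3 - a)) =
    (t - s) * t * (2 * l * t ^ 2 * (t + s) - a)).
  { replace ((t - s) * t * (2 * l * t ^ 2 * (t + s) - a)) with
      (t * (2 * l * t ^ 4 - a * t + (a * s - 2 * l * (s ^ 2 * t ^ 2)))) by ring.
    rewrite hquad; ring. }
  assert (hl3 : l * t ^ 2 * t = l * t ^ 3) by ring.
  assert (0 < l * t ^ 2 * s) by (apply Rmult_lt_0_compat; lra).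
  assert (hpos : 0 < 2 * l * t ^ 2 * (t + s) - a) by lra.
  assert (0 < t * (2 * t * (l * t ^ 3 - a))).
  { repeat apply Rmult_lt_0_compat; lra. }
  destruct (Rlt_le_dec s t) as [|hts]; [assumption|exfalso].
  assert (0 <= (s - t) * (t * (2 * l * t ^ 2 * (t + s) - a))).
  { apply Rmult_le_pos; [lra|apply Rlt_le, Rmult_lt_0_compat; lra]. }
  lra.
- apply Rminus_diag_uniq; rewrite pickup_curve_diff by lra.
  fold a; rewrite <- hquad; field; lra.
Qed.

(** At the critical point [t] minimizes [pickup_curve M l], so the couriers
    needed at a larger arrival rate exceed those at [l]. *)
Lemma critical_no_root M l t l' t' : model_assumptions M ->
  0 < l -> 0 < t -> l * t ^ 3 = idle_scale M -> l < l' -> 0 < t' ->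
  pickup_curve M l t < pickup_curve M l' t'.
Proof.
intros hM hl ht hcrit hl' ht'.
pose proof (delivery_gt0 M hM) as hd.
assert (e : pickup_curve M l' t' - pickup_curve M l t =
  2 * (l' - l) * (t' + delivery M)
  + l * ((t' - t) ^ 2 * (2 * t' + t)) / t' ^ 2).
{ unfold pickup_curve; rewrite <- hcrit; field; lra. }
assert (0 < 2 * (l' - l) * (t' + delivery M)).
{ apply Rmult_lt_0_compat; lra. }
assert (0 <= l * ((t' - t) ^ 2 * (2 * t' + t)) / t' ^ 2).
{ apply Rdiv_le_0_compat; [|apply pow_lt; lra].
  apply Rmult_le_pos; [lra|]; apply Rmult_le_pos; [apply pow2_ge_0|lra]. }
lra.
Qed.

(** * Improving on an equilibrium *)

(** The waiting times at the two queues decrease when the utilization [r] and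
    the ratio [r / l] do: the time is [(r / l) r ^ (k - 1) / (1 - r)]. *)
Lemma queue_time_le k l l' r r' : 1 <= k -> 0 < l -> 0 < l' ->
  0 < r <= r' -> r' < 1 -> r / l <= r' / l' ->
  Rpower r k / (l * (1 - r)) <= Rpower r' k / (l' * (1 - r')).
Proof.
intros hk hl hl' hr hr' hrl.
assert (hsplit : forall x y, 0 < x < 1 -> 0 < y ->
  Rpower x k / (y * (1 - x)) = x / y * (Rpower x (k - 1) * / (1 - x))).
{ intros x y hx hy.
  replace k with (1 + (k - 1)) at 1 by ring.
  rewrite Rpower_plus, Rpower_1 by lra; field; lra. }
assert (hpow : forall x, 0 < Rpower x (k - 1)) by (intro; apply exp_pos).
rewrite !hsplit by lra.
assert (0 < / (1 - r)) by (apply Rinv_0_lt_compat; lra).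
apply Rmult_le_compat; [| |exact hrl|].
- apply Rlt_le, Rdiv_lt_0_compat; lra.
- apply Rlt_le, Rmult_lt_0_compat; [apply hpow|lra].
- apply Rmult_le_compat; [apply Rlt_le, hpow|lra| |].
  + apply Rle_Rpower_l; lra.
  + apply Rinv_le_contravar; lra.
Qed.

Lemma sqrt_double_add2_ge1 x : 0 < x -> 1 <= sqrt (2 * x + 2).
Proof. intros hx; rewrite <- sqrt_1; apply sqrt_le_1_alt; lra. Qed.

(** Under these hypotheses there is an equilibrium with the same couriers and
    wage as [X], arrival rate [l], pickup time [t] and generalized cost [G].  Its
    response and waiting times are no longer than those of [X], so its price
    exceeds that of [X] by at least the value of the saved pickup time plus the
    increase of the generalized cost. *)
Lemma optimum_no_better M X l t G : model_assumptions M -> optimum M X ->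
  0 < l <= arrival X -> t <= pickup X -> pickup_eq M l (couriers X) t ->
  l = tau M * lambda0 M * Fv M G ->
  l * (price X + alpha M * (pickup X - t) + (G - generalized_cost M X))
    <= arrival X * price X.
Proof.
intros hM [hE hopt] hl ht hp hG.
pose proof (delivery_gt0 M hM) as hd.
pose proof (couriers_gt0 M X hE) as hn.
pose proof (beta_gt0 M hM) as hb; pose proof (beta_lt_alpha M hM) as hab.
pose proof (stations_gt0 M hM) as hK; pose proof (chargers_gt0 M hM) as hS.
pose proof (tc_gt0 M hM) as htc.
assert (ht0 : 0 < t) by (apply (pickup_eqE M l (couriers X) t hM); exact hp).
set (rd := 2 * l * (t + delivery M) / couriers X).
set (rc := l * tc M / (stations M * chargers M)).
set (tr := Rpower rd (sqrt (2 * couriers X + 2)) / (2 * l * (1 - rd))).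
set (tw := stations M * Rpower rc (sqrt (2 * chargers M + 2))
             / (l * (1 - rc))).
set (p := G - alpha M * (tr + t) - beta M * (2 * delivery M + tw)).
set (Y := Outcome p (wage X * couriers X / (2 * l * (t + delivery M)))
            l (couriers X) (wage X) t tr tw).
assert (hKS : 0 < stations M * chargers M) by (apply Rmult_lt_0_compat; lra).
assert (htd : 0 < l * (t + delivery M)) by (apply Rmult_lt_0_compat; lra).
assert (hrd0 : 0 < rd) by (apply Rdiv_lt_0_compat; lra).
assert (hrc0 : 0 < rc).
{ apply Rdiv_lt_0_compat; [apply Rmult_lt_0_compat|]; lra. }
assert (hrdle : rd <= rho_d M X).
{ unfold rd, rho_d; apply Rmult_le_compat_r.
  - apply Rlt_le, Rinv_0_lt_compat; lra.
  - apply Rmult_le_compat; lra. }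
assert (hrcle : rc <= rho_c M X).
{ unfold rc, rho_c; apply Rmult_le_compat_r.
  - apply Rlt_le, Rinv_0_lt_compat; lra.
  - apply Rmult_le_compat_r; lra. }
pose proof (rho_d_lt1 M X hE) as hrd1; pose proof (rho_c_lt1 M X hE) as hrc1.
assert (htr : tr <= response X).
{ rewrite (response_eq M X hE); apply queue_time_le; try lra.
  - apply sqrt_double_add2_ge1; lra.
  - unfold rd, rho_d.
    replace (2 * l * (t + delivery M) / couriers X / (2 * l))
      with ((t + delivery M) / couriers X) by (field; lra).
    replace (2 * arrival X * (pickup X + delivery M) / couriers X
             / (2 * arrival X))
      with ((pickup X + delivery M) / couriers X) by (field; lra).
    apply Rmult_le_compat_r; [apply Rlt_le, Rinv_0_lt_compat|]; lra. }
assert (htw : tw <= waiting X).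
{ rewrite (waiting_eq M X hE); unfold tw, Rdiv.
  rewrite !(Rmult_assoc (stations M)); apply Rmult_le_compat_l; [lra|].
  apply queue_time_le; try lra.
  - apply sqrt_double_add2_ge1; lra.
  - apply Req_le; unfold rc, rho_c; field; lra. }
assert (hY : equilibrium M Y).
{ constructor; unfold rho_d, rho_c, generalized_cost; simpl;
    try fold rd; try fold rc; try reflexivity; try lra.
  - rewrite hG; f_equal; f_equal; unfold p; ring.
  - apply (supply_eq M X hE).
  - field; lra.
  - exact hp. }
specialize (hopt Y hY); unfold profit in hopt; simpl in hopt.
assert (hprice : price X + alpha M * (pickup X - t)
                 + (G - generalized_cost M X) <= p).
{ unfold p, generalized_cost.
  assert (alpha M * tr <= alpha M * response X)
    by (apply Rmult_le_compat_l; lra).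
  assert (beta M * tw <= beta M * waiting X)
    by (apply Rmult_le_compat_l; lra).
  lra. }
apply Rle_trans with (l * p); [apply Rmult_le_compat_l|]; lra.
Qed.

Lemma optimum_subcritical M X : model_assumptions M -> optimum M X ->
  arrival X * pickup X ^ 3 <= idle_scale M.
Proof.
intros hM hX; pose proof (proj1 hX) as hE.
pose proof (arrival_gt0 M X hE) as hl.
pose proof (beta_gt0 M hM) as hb; pose proof (beta_lt_alpha M hM) as hab.
destruct (proj1 (pickup_eqE M _ _ _ hM) (pickup_eqn M X hE)) as [ht hn].
apply Rnot_lt_le; intros hlt.
destruct (smaller_root M (arrival X) (pickup X)) as [s [hs es]];
  [apply idle_scale_gt0; assumption|assumption..|].
assert (hle : arrival X * (price X + alpha M * (pickup X - s)
    + (generalized_cost M X - generalized_cost M X))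
  <= arrival X * price X).
{ apply optimum_no_better; try assumption; try lra.
  - apply pickup_eqE; [exact hM|split; lra].
  - apply (demand_eq M X hE). }
assert (0 < arrival X * (alpha M * (pickup X - s))).
{ repeat apply Rmult_lt_0_compat; lra. }
lra.
Qed.

(** Otherwise the price could be raised without losing any customer. *)
Lemma optimum_demand_drops M X : model_assumptions M -> optimum M X ->
  exists G, generalized_cost M X < G /\
    Fv M G < Fv M (generalized_cost M X).
Proof.
intros hM hX; pose proof (proj1 hX) as hE.
pose proof (arrival_gt0 M X hE) as hl.
exists (generalized_cost M X + 1); split; [lra|].
destruct (Fv_decreasing M hM (generalized_cost M X)
            (generalized_cost M X + 1)) as [|heq]; [lra|assumption|exfalso].
assert (hle : arrival X * (price X + alpha M * (pickup X - pickup X)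
    + (generalized_cost M X + 1 - generalized_cost M X))
  <= arrival X * price X).
{ apply optimum_no_better; try assumption; try lra.
  - apply (pickup_eqn M X hE).
  - rewrite heq; apply (demand_eq M X hE). }
lra.
Qed.

(** * Optima are not critical when demand is continuous *)

(** The arrival rate at which [n] couriers sustain the pickup time [t]. *)
Definition sustained_arrival (M : model) (n t : R) : R :=
  (n - idle_scale M / t ^ 2) / (2 * (t + delivery M)).

Lemma sustained_arrivalE M n t : model_assumptions M -> 0 < t ->
  n = pickup_curve M (sustained_arrival M n t) t.
Proof.
intros hM ht; pose proof (delivery_gt0 M hM).
unfold pickup_curve, sustained_arrival; field; lra.
Qed.

(** All slightly smaller arrival rates are attained, at generalized costs no
    lower than that of [X]. *)
Lemma demand_attained M X : model_assumptions M -> optimum M X ->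
  (forall x, continuous (Fv M) x) ->
  exists d, d < arrival X /\ forall l, d < l <= arrival X ->
    exists G, generalized_cost M X <= G /\ l = tau M * lambda0 M * Fv M G.
Proof.
intros hM hX hc; pose proof (proj1 hX) as hE.
destruct (optimum_demand_drops M X hM hX) as [G1 [hG1 hF]].
set (c := tau M * lambda0 M).
assert (hc0 : 0 < c) by (apply Rmult_lt_0_compat; apply hM).
pose proof (demand_eq M X hE) as hdem; fold c in hdem.
exists (c * Fv M G1); split.
{ rewrite hdem; apply Rmult_lt_compat_l; assumption. }
intros l hl.
destruct (IVT_gen (Fv M) (generalized_cost M X) G1 (l / c)) as [G [hG eG]].
- intros x; apply continuity_pt_filterlim, hc.
- rewrite Rmin_right, Rmax_left by lra.
  split; [apply Rle_div_r|apply Rle_div_l]; lra.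
- rewrite Rmin_left, Rmax_right in hG by lra.
  exists G; split; [lra|rewrite eG; field; lra].
Qed.

Lemma optimum_not_critical M X : model_assumptions M -> optimum M X ->
  (forall x, continuous (Fv M) x) ->
  arrival X * pickup X ^ 3 <> idle_scale M.
Proof.
intros hM hX hc hcrit; pose proof (proj1 hX) as hE.
pose proof (arrival_gt0 M X hE) as hl.
pose proof (delivery_gt0 M hM) as hd.
pose proof (beta_gt0 M hM) as hb; pose proof (beta_lt_alpha M hM) as hab.
destruct (proj1 (pickup_eqE M _ _ _ hM) (pickup_eqn M X hE)) as [ht hn].
destruct (demand_attained M X hM hX hc) as [d [hd1 hatt]].
set (t0 := pickup X) in *; set (n := couriers X) in *.
set (l0 := arrival X) in *; set (L := sustained_arrival M n).
(* [t0 - t] times [e t] is the number of customers lost at pickup time [t] *)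
set (e := fun t => l0 * (t0 - t) * (t0 + 2 * t) / (2 * t ^ 2 * (t + delivery M))).
assert (hL : forall t, 0 < t -> l0 - L t = (t0 - t) * e t).
{ intros t htt; unfold L, e, sustained_arrival; rewrite hn.
  unfold pickup_curve; rewrite <- hcrit; field; lra. }
assert (hL0 : L t0 = l0).
{ pose proof (hL t0 ht) as h; rewrite Rminus_diag, Rmult_0_l in h; lra. }
assert (he0 : e t0 = 0) by (unfold e; field; lra).
assert (ce : continuity_pt e t0).
{ apply derivable_continuous_pt; apply ex_derive_Reals_0.
  unfold e; auto_derive; solve_pos_neq. }
assert (cL : continuity_pt L t0).
{ apply derivable_continuous_pt; apply ex_derive_Reals_0.
  unfold L, sustained_arrival; auto_derive; solve_pos_neq. }
assert (cgain : continuity_pt (fun t => alpha M * L t - price X * e t) t0).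
{ apply continuity_pt_minus; apply continuity_pt_scal; assumption. }
apply continuity_pt_filterlim in cL.
apply continuity_pt_filterlim in cgain.
assert (near : locally t0 (fun t => 0 < t /\ Rmax d 0 < L t /\
  0 < alpha M * L t - price X * e t)).
{ repeat apply filter_and.
  - apply (open_gt 0 t0 ht).
  - apply cL, (open_gt (Rmax d 0)).
    rewrite hL0; apply Rmax_lub_lt; lra.
  - apply cgain, (open_gt 0).
    rewrite hL0, he0, Rmult_0_r, Rminus_0_r; apply Rmult_lt_0_compat; lra. }
destruct near as [r hr].
pose proof (cond_pos r) as hr0.
set (t := t0 - r / 2).
destruct (hr t) as [ht1 [hLt hgain]].
{ unfold ball, t; simpl; unfold AbsRing_ball, abs, minus, plus, opp; simpl.
  rewrite Rabs_left; lra. }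
assert (htt : t < t0) by (unfold t; lra).
pose proof (Rmax_l d 0); pose proof (Rmax_r d 0).
pose proof (hL t ht1) as hdiff.
assert (hle : L t <= l0).
{ assert (0 <= e t).
  { apply Rdiv_le_0_compat.
    - repeat apply Rmult_le_pos; lra.
    - repeat apply Rmult_lt_0_compat; try apply pow_lt; lra. }
  assert (0 <= (t0 - t) * e t) by (apply Rmult_le_pos; lra).
  lra. }
destruct (hatt (L t)) as [G [hG eG]]; [lra|].
assert (hno := optimum_no_better M X (L t) t G hM hX).
fold t0 n l0 in hno.
assert (hno' : L t * (price X + alpha M * (t0 - t)
    + (G - generalized_cost M X)) <= l0 * price X).
{ apply hno; [lra..| |exact eG].
  apply pickup_eqE; [exact hM|split; [exact ht1|]].
  apply sustained_arrivalE; assumption. }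
assert (0 <= L t * (G - generalized_cost M X)) by (apply Rmult_le_pos; lra).
assert (hpos : 0 < (t0 - t) * (alpha M * L t - price X * e t)).
{ apply Rmult_lt_0_compat; lra. }
assert (el : l0 = L t + (t0 - t) * e t) by lra.
rewrite el in hno'; lra.
Qed.

(** * Branches through a subcritical outcome *)

(** The pickup time increases by [(l - l0) Q], where [Q] is a continuous
    function of the new pickup time. *)
Lemma branch_is_derive M (f : R -> R) l0 n : model_assumptions M ->
  0 < l0 -> 0 < f l0 -> l0 * f l0 ^ 3 < idle_scale M -> continuous f l0 ->
  locally l0 (fun l => pickup_eq M l n (f l)) ->
  exists D, 0 < D /\ is_derive f l0 D.
Proof.
intros hM hl ht hsub cf hloc.
pose proof (delivery_gt0 M hM) as hd.
set (t0 := f l0) in *.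
set (q := fun t => idle_scale M * (t + t0) / (t ^ 2 * t0 ^ 2) - 2 * l0).
set (Q := fun t => 2 * (t + delivery M) / q t).
assert (ht3 : 0 < t0 ^ 3) by (apply pow_lt; lra).
assert (hq0 : 0 < q t0).
{ replace (q t0) with (2 * (idle_scale M - l0 * t0 ^ 3) / t0 ^ 3)
    by (unfold q; field; lra).
  apply Rdiv_lt_0_compat; lra. }
assert (cq : continuity_pt q t0).
{ apply derivable_continuous_pt; apply ex_derive_Reals_0.
  unfold q; auto_derive; solve_pos_neq. }
assert (cQ : continuous Q t0).
{ apply continuity_pt_filterlim; unfold Q.
  apply continuity_pt_div; [|exact cq|lra].
  apply derivable_continuous_pt; apply ex_derive_Reals_0; auto_derive; auto. }
assert (cQf : continuous (fun l => Q (f l)) l0).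
{ apply continuous_comp; assumption. }
apply continuity_pt_filterlim in cq.
exists (Q t0); split; [apply Rdiv_lt_0_compat; lra|].
assert (hroot0 := proj1 (pickup_eqE M _ _ _ hM) (locally_singleton _ _ hloc)).
fold t0 in hroot0.
assert (hpos : locally l0 (fun l => 0 < q (f l))).
{ apply (continuous_comp f q l0 cf cq), (open_gt 0); exact hq0. }
assert (hfact : locally l0 (fun l => f l - t0 = (l - l0) * Q (f l))).
{ generalize (filter_and _ _ hpos hloc); apply filter_imp.
  intros l [hql hpl].
  apply pickup_eqE in hpl; [|exact hM].
  assert (hdiff := pickup_curve_diff M l0 t0 l (f l) ht (proj1 hpl)).
  fold (q (f l)) in hdiff.
  apply Rmult_eq_reg_r with (q (f l)); [|lra].
  unfold Q; transitivity (2 * (l - l0) * (f l + delivery M)); [|field]; lra. }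
apply is_derive_Reals; intros eps heps.
assert (hball : locally l0 (fun l => Rabs (Q (f l) - Q t0) < eps)).
{ apply (cQf (fun y => Rabs (y - Q t0) < eps)).
  exists (mkposreal eps heps); intros y hy; exact hy. }
destruct (filter_and _ _ hfact hball) as [delta hdelta].
exists delta; intros h hh hhd.
destruct (hdelta (l0 + h)) as [e1 e2].
{ unfold ball; simpl; unfold AbsRing_ball, abs, minus, plus, opp; simpl.
  replace (l0 + h + - l0) with h by ring; exact hhd. }
fold t0; rewrite e1.
replace ((l0 + h - l0) * Q (f (l0 + h)) / h) with (Q (f (l0 + h)))
  by (field; exact hh).
exact e2.
Qed.

(** A root below [b] exists as soon as [b] requires fewer than [n] couriers,
    since [sqrt (a / n)] requires more. *)
Lemma root_exists M l n b : model_assumptions M -> 0 < l -> 0 < b ->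
  pickup_curve M l b < n -> exists t, 0 < t <= b /\ n = pickup_curve M l t.
Proof.
intros hM hl hb hn.
pose proof (delivery_gt0 M hM) as hd; pose proof (idle_scale_gt0 M hM) as ha.
assert (hb2 : 0 < b ^ 2) by (apply pow_lt; lra).
assert (hlb : 0 < l * (b + delivery M)) by (apply Rmult_lt_0_compat; lra).
assert (hab : idle_scale M / b ^ 2 < n) by (unfold pickup_curve in hn; lra).
assert (hn0 : 0 < n).
{ apply Rlt_trans with (idle_scale M / b ^ 2); [apply Rdiv_lt_0_compat|]; lra. }
assert (hq : 0 < idle_scale M / n) by (apply Rdiv_lt_0_compat; lra).
set (x := sqrt (idle_scale M / n)).
assert (hx : 0 < x) by (apply sqrt_lt_R0; exact hq).
assert (hx2 : x ^ 2 = idle_scale M / n) by (apply pow2_sqrt; lra).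
assert (hxb : x <= b).
{ rewrite <- (sqrt_pow2 b) by lra; apply sqrt_le_1_alt.
  apply Rle_div_l; [lra|]; apply Rlt_div_l in hab; lra. }
assert (hlx : 0 < l * (x + delivery M)) by (apply Rmult_lt_0_compat; lra).
assert (hnx : n < pickup_curve M l x).
{ unfold pickup_curve; rewrite hx2.
  replace (idle_scale M / (idle_scale M / n)) with n by (field; lra); lra. }
destruct (Ranalysis5.IVT_interv (fun t => n - pickup_curve M l t) x b)
  as [t [ht et]].
- intros t ht.
  apply derivable_continuous_pt; apply ex_derive_Reals_0.
  unfold pickup_curve; auto_derive; solve_pos_neq.
- destruct hxb as [|heq]; [assumption|rewrite heq in hnx; lra].
- lra.
- lra.
- exists t; split; lra.
Qed.

Lemma branch_exists M X : model_assumptions M -> equilibrium M X ->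
  arrival X * pickup X ^ 3 < idle_scale M -> exists g, pickup_branch M X g.
Proof.
intros hM hE hsub.
pose proof (delivery_gt0 M hM) as hd; pose proof (idle_scale_gt0 M hM) as ha.
pose proof (arrival_gt0 M X hE) as hl.
destruct (proj1 (pickup_eqE M _ _ _ hM) (pickup_eqn M X hE)) as [ht hn].
unfold pickup_branch.
set (t0 := pickup X) in *; set (n0 := couriers X) in *.
set (l0 := arrival X) in *.
(* [b] lies strictly between [t0] and the critical pickup time *)
assert (exists b, t0 < b /\ l0 * b ^ 3 < idle_scale M) as [b [hb hbsub]].
{ assert (cc : continuity_pt (fun b => l0 * b ^ 3) t0).
  { apply derivable_continuous_pt; apply ex_derive_Reals_0; auto_derive; auto. }
  apply continuity_pt_filterlim in cc.
  destruct (cc _ (open_lt (idle_scale M) _ hsub)) as [r hr].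
  pose proof (cond_pos r) as hr0.
  exists (t0 + r / 2); split; [lra|]; apply hr.
  unfold ball; simpl; unfold AbsRing_ball, abs, minus, plus, opp; simpl.
  rewrite Rabs_right; lra. }
assert (hb3 : 0 < b ^ 3) by (apply pow_lt; lra).
set (k := 2 * idle_scale M / b ^ 3 - 2 * l0).
assert (hk : 0 < k).
{ replace k with (2 * (idle_scale M - l0 * b ^ 3) / b ^ 3)
    by (unfold k; field; lra).
  apply Rdiv_lt_0_compat; lra. }
(* any root below [b] is within a Lipschitz bound of [t0] *)
assert (hlip : forall l n t, 0 < t <= b -> n = pickup_curve M l t ->
  k * Rabs (t - t0) <= 2 * (b + delivery M) * Rabs (l - l0) + Rabs (n - n0)).
{ intros l n t htb hnt.
  pose proof (pickup_curve_diff M l0 t0 l t ht (proj1 htb)) as hdiff.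
  rewrite <- hn, <- hnt in hdiff.
  assert (hslope : 2 * idle_scale M / b ^ 3
    <= idle_scale M * (t + t0) / (t ^ 2 * t0 ^ 2)) by (apply slope_ge; lra).
  set (q := idle_scale M * (t + t0) / (t ^ 2 * t0 ^ 2) - 2 * l0) in *.
  assert (hkq : k <= q) by (unfold k, q; lra).
  apply Rle_trans with (Rabs (t - t0) * q).
  { rewrite Rmult_comm; apply Rmult_le_compat_l; [apply Rabs_pos|exact hkq]. }
  rewrite <- (Rabs_pos_eq q) at 1 by lra.
  rewrite <- Rabs_mult.
  replace ((t - t0) * q)
    with (2 * (t + delivery M) * (l - l0) + - (n - n0)) by lra.
  eapply Rle_trans; [apply Rabs_triang|].
  rewrite Rabs_Ropp, Rabs_mult, (Rabs_pos_eq (2 * _)) by lra.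
  apply Rplus_le_compat_r, Rmult_le_compat_r; [apply Rabs_pos|lra]. }
(* the value of [g] matters only where a root below [b] exists *)
set (g := fun l n =>
  epsilon (inhabits 0) (fun t => 0 < t <= b /\ n = pickup_curve M l t)).
assert (hg : forall l n, 0 < l -> pickup_curve M l b < n ->
  0 < g l n <= b /\ n = pickup_curve M l (g l n)).
{ intros l n hl' hn'.
  apply (epsilon_spec (inhabits 0)
           (fun t => 0 < t <= b /\ n = pickup_curve M l t)).
  apply root_exists; try assumption; lra. }
assert (hbn : pickup_curve M l0 b < n0).
{ rewrite hn; apply Rminus_lt_0.
  rewrite pickup_curve_diff, Rminus_diag by lra.
  assert (hslope : 2 * idle_scale M / b ^ 3
    <= idle_scale M * (t0 + b) / (t0 ^ 2 * b ^ 2)) by (apply slope_ge; lra).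
  assert (0 < (b - t0) *
    (idle_scale M * (t0 + b) / (t0 ^ 2 * b ^ 2) - 2 * l0)).
  { apply Rmult_lt_0_compat; unfold k in hk; lra. }
  lra. }
set (m := 1 + 2 * (b + delivery M)).
assert (hm : 0 < m) by (unfold m; lra).
(* radius within which the hypotheses of [hg] persist *)
set (r := Rmin l0 ((n0 - pickup_curve M l0 b) / m)).
assert (hr : 0 < r) by (apply Rmin_glb_lt; [|apply Rdiv_lt_0_compat]; lra).
assert (hr1 : r <= l0) by apply Rmin_l.
assert (hr2 : r * m <= n0 - pickup_curve M l0 b).
{ apply Rle_div_r; [lra|apply Rmin_r]. }
assert (hgr : forall l n, Rabs (l - l0) < r -> Rabs (n - n0) < r ->
  0 < g l n <= b /\ n = pickup_curve M l (g l n)).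
{ intros l n hlr hnr; apply Rabs_def2 in hlr; apply Rabs_def2 in hnr.
  apply hg; [lra|].
  assert ((l - l0) * (2 * (b + delivery M)) <= r * (2 * (b + delivery M)))
    by (apply Rmult_le_compat_r; lra).
  unfold m in hr2; unfold pickup_curve in *; lra. }
assert (hg0 : g l0 n0 = t0).
{ destruct (hg l0 n0 hl hbn) as [hgb hgn].
  pose proof (hlip l0 n0 _ hgb hgn) as h.
  rewrite !Rminus_diag, Rabs_R0, Rmult_0_r, Rplus_0_r in h.
  pose proof (Rabs_pos (g l0 n0 - t0)).
  apply Rminus_diag_uniq, Rabs_eq_0; nra. }
exists g; split; [exact hg0|split].
- intros eps.
  pose proof (cond_pos eps) as heps.
  assert (hdelta : 0 < Rmin r (k * eps / m)).
  { apply Rmin_glb_lt; [lra|].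
    apply Rdiv_lt_0_compat; [apply Rmult_lt_0_compat|]; lra. }
  exists (mkposreal _ hdelta); simpl; intros l n hl' hn'.
  pose proof (Rmin_l r (k * eps / m)) as hmin1.
  pose proof (Rmin_r r (k * eps / m)) as hmin2.
  destruct (hgr l n) as [hgb hgn]; [lra..|].
  pose proof (hlip l n _ hgb hgn) as h.
  rewrite hg0.
  apply Rmult_lt_reg_l with k; [exact hk|].
  eapply Rle_lt_trans; [exact h|].
  assert (h1 : 2 * (b + delivery M) * Rabs (l - l0)
    <= 2 * (b + delivery M) * (k * eps / m)) by (apply Rmult_le_compat_l; lra).
  replace (k * eps) with (2 * (b + delivery M) * (k * eps / m) + k * eps / m)
    by (unfold m; field; unfold m in hm; lra).
  lra.
- exists (mkposreal r hr); simpl; intros l n hl' hn'.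
  apply pickup_eqE; [exact hM|].
  destruct (hgr l n hl' hn') as [hgb hgn]; split; [lra|exact hgn].
Qed.

Theorem lemma1 (M : model) (hM : model_assumptions M)
    (X : outcome) (hX : optimum M X) :
  (forall g : R -> R -> R, pickup_branch M X g ->
     ex_derive (fun l => g l (couriers X)) (arrival X) /\
     0 < Derive (fun l => g l (couriers X)) (arrival X)) /\
  ((forall x : R, continuous (Fv M) x) -> exists g : R -> R -> R, pickup_branch M X g).
Proof.
pose proof (proj1 hX) as hE.
pose proof (arrival_gt0 M X hE) as hl.
destruct (proj1 (pickup_eqE M _ _ _ hM) (pickup_eqn M X hE)) as [ht hn].
pose proof (optimum_subcritical M X hM hX) as hsub.
split.
- intros g [hg0 [hgc hgl]].
  assert (hloc : locally (arrival X)
    (fun l => pickup_eq M l (couriers X) (g l (couriers X)))).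
  { destruct hgl as [d hd]; exists d; intros l hball.
    apply hd; [exact hball|].
    rewrite Rminus_diag, Rabs_R0; apply cond_pos. }
  assert (hcont : continuous (fun l => g l (couriers X)) (arrival X)).
  { apply filterlim_locally; intros eps.
    destruct (hgc eps) as [d hd]; exists d; intros l hball.
    apply hd; [exact hball|].
    rewrite Rminus_diag, Rabs_R0; apply cond_pos. }
  assert (hlt : arrival X * pickup X ^ 3 < idle_scale M).
  { destruct hsub as [|heq]; [assumption|exfalso].
    destruct hloc as [d hd]; pose proof (cond_pos d) as hd0.
    destruct (proj1 (pickup_eqE M _ _ _ hM) (hd (arrival X + d / 2) ltac:(
      unfold ball; simpl; unfold AbsRing_ball, abs, minus, plus, opp; simpl;
      rewrite Rabs_right; lra))) as [ht' hn'].
    assert (pickup_curve M (arrival X) (pickup X) <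
      pickup_curve M (arrival X + d / 2)
        (g (arrival X + d / 2) (couriers X))).
    { apply critical_no_root; try assumption; lra. }
    lra. }
  destruct (branch_is_derive M (fun l => g l (couriers X)) (arrival X)
    (couriers X) hM hl) as [D [hD hder]]; try assumption.
  + rewrite hg0; exact ht.
  + rewrite hg0; exact hlt.
  + split; [exists D; exact hder|].
    rewrite (is_derive_unique _ _ _ hder); exact hD.
- intros hc; apply branch_exists; [exact hM|exact hE|].
  destruct hsub as [|heq]; [assumption|].
  exfalso; exact (optimum_not_critical M X hM hX hc heq).
Qed.
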